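(* Let $n\ge1$ and $d\ge0$ be integers. Let $R(z,\overline z)$ be a (complex-valued) real-analytic function defined near the origin in $\mathbf{C}^n$. Suppose that $R$ is not identically zero near the origin, and that $R$ is a multiple of $\|z\|^{2d}$, i.e. $R(z,\overline z)=\|z\|^{2d}\,r(z,\overline z)$ near the origin for some (complex-valued) real-analytic function $r$ defined near the origin. Then $\mathbf{r}(R)\ge N(n,d)$. Equality is possible: for example, equality holds when $R=\|z\|^{2d}$.
   Context: For $z=(z_1,\dots,z_n)\in\mathbf{C}^n$ write $\|z\|^2=\sum_{j=1}^n|z_j|^2$. A real-analytic function $R$ near the origin in $\mathbf{C}^n$ has a convergent expansion $R(z,\overline z)=\sum_{\alpha,\beta}c_{\alpha,\beta}z^\alpha\overline z^\beta$ near the origin, with multi-indices $\alpha,\beta\in\mathbf{Z}_{\ge0}^n$ and $c_{\alpha,\beta}\in\mathbf{C}$. The rank $\mathbf{r}(R)$ is the rank of the possibly infinite matrix $(c_{\alpha,\beta})$; the value $\infty$ is allowed. The number $N(n,d)=\binom{n+d-1}{d}$ is the dimension of the space of homogeneous polynomials of degree $d$ in $n$ variables. *)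

(* Defs.v *)
From HB Require Import structures.
From mathcomp Require Import all_boot all_order all_algebra.
From mathcomp Require Import complex.
From mathcomp Require Import all_classical all_reals all_analysis.
From mathcomp.analysis.showcase Require summability.

Set Implicit Arguments.
Unset Strict Implicit.
Unset Printing Implicit Defensive.

Import Order.TTheory GRing.Theory Num.Theory.
Import numFieldNormedType.Exports.
#[export] Existing Instance summability.totally_filter.

Local Open Scope classical_set_scope.
Local Open Scope ring_scope.

(* Naming the field structure lets the topology of a numClosedFieldType be
   inferred, which it is not on the bare carrier [R[i]]. *)
Definition Cx (R : realType) : numClosedFieldType := R[i].

Notation multi_index n := {ffun 'I_n -> nat}.

Section HermitianExpansion.
Variables (R : realType) (n : nat).
Local Notation C := (Cx R).
Implicit Types (z : 'rV[C]_n) (F : 'rV[C]_n -> C).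
Implicit Types (c : multi_index n -> multi_index n -> C).

Definition monomial (a : multi_index n) z : C := \prod_(j < n) z 0 j ^+ a j.

Definition conj_vec z : 'rV[C]_n := map_mx Num.conj z.

Definition sqnorm z : C := \sum_(j < n) `|z 0 j| ^+ 2.

Definition expansion_term c z (ab : multi_index n * multi_index n) : C :=
  c ab.1 ab.2 * monomial ab.1 z * monomial ab.2 (conj_vec z).

(* Unordered summation over all pairs of multi-indices; over the complex
   numbers this is the same as absolute convergence.  Functions are total, but
   only the germ of F at the origin matters. *)
Definition is_expansion F c : Prop :=
  \forall z \near (0 : 'rV[C]_n),
    summability.partial_sum (expansion_term c z) @ summability.totally --> F z.

Definition real_analytic0 F : Prop := exists c, is_expansion F c.

(* The coefficients of a convergent expansion are unique, so the choice made by
   [xget] is immaterial; the default 0 is used only if F is not analytic. *)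
Definition coef_matrix F : multi_index n -> multi_index n -> C :=
  xget (fun _ _ => 0) [set c | is_expansion F c].

End HermitianExpansion.

Section InfiniteMatrixRank.
Variables (R : realType) (K : fieldType) (I J : Type).
Implicit Type A : I -> J -> K.

Definition independent_rows A (k : nat) (s : 'I_k -> I) : Prop :=
  forall l : 'I_k -> K,
    (forall j : J, \sum_(i < k) l i * A (s i) j = 0) -> forall i, l i = 0.

(* Dimension of the span of the rows, +oo if it is infinite-dimensional. *)
Definition inf_rank A : \bar R :=
  ereal_sup [set (k%:R)%:E | k in
    [set k : nat | exists s : 'I_k -> I, independent_rows A s]].

End InfiniteMatrixRank.

Definition rankR (R : realType) (n : nat) (F : 'rV[Cx R]_n -> Cx R) : \bar R :=
  inf_rank R (coef_matrix F).

(* Main.v *)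
(* Write the coefficients of [F = ||z||^(2d) r] as [S^d c], where [c] are those of
   [r] and [S c (a, b) = sum_j c (a - e_j, b - e_j)].  Keep only one bidegree and,
   for a weight [w] separating the exponents that occur, only the pairs [(a, b)]
   of maximal [w a - w b].  The matrix of [S^d c] is triangular along these pairs,
   so its rank is at least the number of nonzero entries on them.  That number is
   at least [N(n,d) = N(n-1,d) + N(n,d-1)], by induction: the terms of [S^d c] of
   lowest degree [e] in the first variable are a multiple of the [d]-th power of
   [S] in the other variables, and the remaining terms are those of
   [(z_1 d/dz_1 - e) (S^d c)], which is a multiple of [S^(d-1)].

   The coefficients of an expansion of 0 vanish: its part of lowest total degree
   is zero, and [z_j = zeta^(B^j)] turns it into a polynomial in [zeta] and its
   conjugate with the same coefficients. *)
Require Import Defs.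
From HB Require Import structures.
From mathcomp Require Import all_boot all_order all_algebra.
From mathcomp Require Import complex finmap zify ring.
From mathcomp Require Import all_classical all_reals all_analysis.
Import Order.TTheory GRing.Theory Num.Theory.
Import numFieldNormedType.Exports.
Local Open Scope classical_set_scope.
Local Open Scope ring_scope.

Set Implicit Arguments.
Unset Strict Implicit.
Unset Printing Implicit Defensive.

(** * Multiplication by [|z_j|^2] on coefficients, and the number of nonzero entries *)

Section Shift.
Variables (K : numDomainType) (n : nat).
Implicit Types (c f g : multi_index n -> multi_index n -> K) (a b : multi_index n).
Implicit Types (j k : 'I_n) (l : seq 'I_n).

Definition mdeg a : nat := (\sum_j a j)%N.

Definition mdown j a : multi_index n := [ffun k => (a k - (k == j))%N].
Definition mup j a : multi_index n := [ffun k => (a k + (k == j))%N].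

(* Coefficients of [z_j * conj z_j * F] when [c] are those of [F]. *)
Definition shift j c a b : K :=
  if (0 < a j)%N && (0 < b j)%N then c (mdown j a) (mdown j b) else 0.

Definition shifts l c a b : K := \sum_(j <- l) shift j c a b.

(** Only the degree in [z] is bounded. This is enough for a largest exponent of each [z_j] to
    exist. *)
Definition row_bounded c : Prop :=
  exists B : nat, forall a b, c a b != 0 -> (mdeg a <= B)%N.

Lemma mupK j : cancel (mup j) (mdown j).
Proof. by move=> a; apply/ffunP => k; rewrite !ffunE addnK. Qed.

Lemma mdownK j a : (0 < a j)%N -> mup j (mdown j a) = a.
Proof.
move=> aj; apply/ffunP => k; rewrite !ffunE.
by case: (eqVneq k j) => [->|_]; rewrite ?subnK // subn0 addn0.
Qed.

Lemma iter_mup j i a : iter i (mup j) a j = (a j + i)%N.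
Proof.
by elim: i => [|i IH]; rewrite ?addn0 //= ffunE eqxx IH -addnA addn1.
Qed.

(** Arbitrary weights are allowed so as to serve both the total degree and the base-[B] weight used
    later. *)
Lemma weighted_mdown (w : 'I_n -> nat) j a : (0 < a j)%N ->
  (\sum_k a k * w k = (\sum_k mdown j a k * w k) + w j)%N.
Proof.
move=> aj; rewrite (bigD1 j) //= [in RHS](bigD1 j) //= ffunE eqxx.
rewrite addnAC -[X in (_ + X + _)%N]mul1n -mulnDl subnK //; congr addn.
by apply: eq_bigr => k /negPf kj; rewrite ffunE kj subn0.
Qed.

Lemma mdeg_mdown j a : (0 < a j)%N -> mdeg a = (mdeg (mdown j a)).+1.
Proof.
move=> aj; have := weighted_mdown (fun=> 1%N) aj.
under eq_bigr do rewrite muln1.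
by rewrite /mdeg => ->; under eq_bigr do rewrite muln1; rewrite addn1.
Qed.

Lemma shiftC j k c : shift j (shift k c) = shift k (shift j c).
Proof.
have [->//|kj] := eqVneq k j.
apply/funext => a; apply/funext => b; rewrite /shift !ffunE.
rewrite (negPf kj) eq_sym (negPf kj) !subn0.
have E i i' (x : multi_index n) : mdown i (mdown i' x) = mdown i' (mdown i x).
  by apply/ffunP => y; rewrite !ffunE subnAC.
by rewrite !(E k j); case: (_ && _); case: (_ && _).
Qed.

Lemma shiftsC l k c : shifts l (shift k c) = shift k (shifts l c).
Proof.
apply/funext => a; apply/funext => b; rewrite /shifts.
under eq_bigr do rewrite shiftC.
by rewrite /shift; case: ifP => // _; rewrite big1.
Qed.

Lemma shifts0 l : shifts l (fun _ _ => 0) = (fun _ _ => 0).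
Proof.
apply/funext => a; apply/funext => b; rewrite /shifts big1// => j _.
by rewrite /shift if_same.
Qed.

Lemma iter_shifts0 l d : iter d (shifts l) (fun _ _ => 0) = (fun _ _ => 0).
Proof. by elim: d => //= d ->; exact: shifts0. Qed.

Lemma shiftsD l f g :
  shifts l (fun a b => f a b + g a b) = fun a b => shifts l f a b + shifts l g a b.
Proof.
apply/funext => a; apply/funext => b; rewrite /shifts -big_split /=.
by apply: eq_bigr => j _; rewrite /shift; case: ifP; rewrite ?addr0.
Qed.

Lemma iter_shiftsD l d f g :
  iter d (shifts l) (fun a b => f a b + g a b) =
  fun a b => iter d (shifts l) f a b + iter d (shifts l) g a b.
Proof. by elim: d => //= d ->; exact: shiftsD. Qed.

Lemma iter_shiftsC l d k c :
  iter d (shifts l) (shift k c) = shift k (iter d (shifts l) c).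
Proof. by elim: d => //= d ->; exact: shiftsC. Qed.

Lemma shift_neq0 j c a b : shift j c a b != 0 ->
  [/\ (0 < a j)%N, (0 < b j)%N & c (mdown j a) (mdown j b) != 0].
Proof. by rewrite /shift; case: ifP => [/andP[]//|]; rewrite eqxx. Qed.

Lemma row_bounded_shift j c : row_bounded c -> row_bounded (shift j c).
Proof.
case=> B HB; exists B.+1 => a b /shift_neq0[aj _ /HB].
by rewrite (mdeg_mdown aj).
Qed.

Lemma row_boundedD f g : row_bounded f -> row_bounded g ->
  row_bounded (fun a b => f a b + g a b).
Proof.
case=> B HB [B' HB']; exists (maxn B B') => a b.
have [/eqP-> | /HB h _] := boolP (f a b == 0); last by rewrite leq_max h.
by rewrite add0r => /HB' h; rewrite leq_max h orbT.
Qed.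

Lemma row_bounded_shifts l c :
  row_bounded c -> row_bounded (shifts l c).
Proof.
move=> hc; elim: l => [|j l IH].
  by exists 0%N => a b; rewrite /shifts big_nil eqxx.
rewrite (_ : shifts (j :: l) c = fun a b => shift j c a b + shifts l c a b);
  last first.
  by apply/funext => a; apply/funext => b; rewrite /shifts big_cons.
by apply: row_boundedD IH; exact: row_bounded_shift.
Qed.

(** Finite propagation: an entry of the [d]-fold shift depends only on entries [d] steps below it.
    [Q i] is the region with [i] steps left to descend; taking [g] to be 0 yields vanishing
    statements. *)
Lemma iter_shifts_local l d (Q : nat -> multi_index n -> multi_index n -> Prop) f g :
  (forall i j a b, j \in l -> (0 < a j)%N -> (0 < b j)%N -> Q i.+1 a b ->
     Q i (mdown j a) (mdown j b)) ->
  (forall a b, Q 0 a b -> f a b = g a b) ->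
  forall a b, Q d a b -> iter d (shifts l) f a b = iter d (shifts l) g a b.
Proof.
move=> Qdown fg; elim: d => //= d IH a b Qab.
apply: eq_big_seq => j jl; rewrite /shift; case: ifP => // /andP[aj bj].
exact/IH/Qdown.
Qed.

(* Since [a j] is the exponent of [z_j], this is the Leibniz rule for the Euler
   operator [z_j d/dz_j - e] applied to a multiple of a [d.+1]-st power. *)
Lemma euler_iter_shifts j l e d c : uniq l -> j \in l -> row_bounded c ->
  exists2 c', row_bounded c' &
    forall a b, ((a j)%:R - e%:R) * iter d.+1 (shifts l) c a b =
                iter d (shifts l) c' a b.
Proof.
move=> ul jl fc.
have E f : (fun a b => ((a j)%:R - e%:R) * shifts l f a b) =
   fun a b => shifts l (fun a b => ((a j)%:R - e%:R) * f a b) a b + shift j f a b.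
  apply/funext => a; apply/funext => b.
  rewrite /shifts [in LHS](bigD1_seq j) //= [in X in _ = X + _](bigD1_seq j) //=.
  rewrite addrAC mulrDr mulr_sumr; congr (_ + _).
    rewrite /shift; case: ifP => [/andP[aj _]|]; last by rewrite mulr0 addr0.
    rewrite -[X in _ = _ + X]mul1r -mulrDl ffunE eqxx natrB //.
    by rewrite addrAC subrK.
  apply: eq_bigr => k kj; rewrite /shift; case: ifP => _; last by rewrite mulr0.
  by rewrite ffunE eq_sym (negPf kj) subn0.
elim: d => [|d [c' fc' IH]].
  exists (fun a b => shifts l (fun a b => ((a j)%:R - e%:R) * c a b) a b +
                     shift j c a b).
    apply: row_boundedD; last exact: row_bounded_shift.
    apply: row_bounded_shifts; case: fc => B HB; exists B => a b.
    by rewrite mulf_eq0 negb_or => /andP[_ /HB].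
  by move=> a b; have /(congr1 (fun f => f a b)) := E c.
exists (fun a b => c' a b + shift j c a b).
  by apply: row_boundedD fc' _; exact: row_bounded_shift.
move=> a b; rewrite iterS.
have /(congr1 (fun f => f a b)) /= -> := E (iter d.+1 (shifts l) c).
rewrite iter_shiftsD /= shiftsD /=.
congr (_ + _); last by rewrite iter_shiftsC shiftsC.
by congr (shifts l _ a b); apply/funext => a'; apply/funext => b'; exact: IH.
Qed.

(* The part of [c] of lowest [z_j]-degree sees only the other variables. *)
Lemma iter_shifts_bottom j l d e c a b :
  (forall x y, c x y != 0 -> (e <= x j)%N) -> j \notin l -> (a j <= e)%N ->
  iter d (shifts (j :: l)) c a b =
  iter d (shifts l) (fun x y => if x j == e then c x y else 0) a b.
Proof.
move=> ce jl; elim: d a b => [|d IH] a b ae.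
  rewrite /=; case: ltngtP ae => // ae _; apply/eqP/contraT => /ce.
  by rewrite leqNgt ae.
rewrite !iterS /shifts big_cons.
rewrite {1}/shift; case: ifP => [/andP[aj bj]|_]; last first.
  rewrite add0r; apply: eq_big_seq => k kl; rewrite /shift; case: ifP => // _.
  rewrite IH // ffunE; exact: leq_trans (leq_subr _ _) ae.
rewrite IH; last by rewrite ffunE; exact: leq_trans (leq_subr _ _) ae.
rewrite (@iter_shifts_local l d (fun _ x _ => x j < e)%N _ (fun _ _ => 0)); first last.
- by rewrite ffunE eqxx subn1 prednK.
- by move=> x y; case: ltngtP.
- by move=> i k x y _ _ _ /= h; rewrite ffunE; exact: leq_ltn_trans (leq_subr _ _) h.
rewrite iter_shifts0 add0r; apply: eq_big_seq => k kl; rewrite /shift; case: ifP => // _.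
rewrite IH // ffunE; exact: leq_trans (leq_subr _ _) ae.
Qed.

(** From exponents of [z_j] at most [e], the exponent [e + d] is reached in [d] steps only by
    shifting along [j] every time. *)
Lemma iter_shifts_top j l d e c a b :
  (forall x y, c x y != 0 -> (x j <= e)%N) -> j \notin l -> a j = e ->
  iter d (shifts (j :: l)) c (iter d (mup j) a) (iter d (mup j) b) = c a b.
Proof.
move=> ce jl aj.
have hi i (x y : multi_index n) : (e + i < x j)%N -> iter i (shifts (j :: l)) c x y = 0.
  elim: i x y => [|i IH] x y h.
    by apply/eqP/contraT => /ce; rewrite leqNgt -[e]addn0 h.
  rewrite iterS /shifts big1_seq // => k _; rewrite /shift; case: ifP => // _.
  by apply: IH; rewrite ffunE; lia.
elim: d => //= d IH; rewrite {1}/shifts big_cons {1}/shift.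
rewrite !mupK IH !ffunE eqxx !addn1 /= big1_seq ?addr0 // => k /andP[_ kl].
rewrite /shift; case: ifP => // _; apply: hi.
rewrite !ffunE eqxx iter_mup aj; case: eqVneq jl => [->|_ _]; first by rewrite kl.
by rewrite subn0 addn1.
Qed.

(** A double induction matching Pascal's rule: the lowest slice drops a variable and keeps the
    power, the Euler operator keeps the variables and lowers the power. *)
Lemma card_support_iter_shifts l d c : uniq l ->
  (exists a b, c a b != 0) -> row_bounded c ->
  exists s : seq (multi_index n * multi_index n),
    [/\ uniq s, size s = 'C(size l + d - 1, d) &
        forall ab, ab \in s -> iter d (shifts l) c ab.1 ab.2 != 0].
Proof.
elim: l d c => [|j l IHl] d c.
  (* Without variables the shift is zero. Truncated subtraction makes the binomial 1 for power 0,
     and ['C(d, d.+1) = 0] for power [d.+1]. *)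
  move=> _ [a [b cab]] _; case: d => [|d].
    by exists [:: (a, b)]; split => // ab; rewrite inE => /eqP->.
  by exists [::]; split => //; rewrite /= subn1 bin_small.
move=> ujl; elim: d c => [|d IHd] c [a0 [b0 cab0]] fc.
  exists [:: (a0, b0)]; split => //= [|ab]; first by rewrite bin0.
  by rewrite inE => /eqP->.
pose P e := `[< exists a b, c a b != 0 /\ a j = e >].
have exP : exists e, P e by exists (a0 j); apply/asboolP; exists a0, b0.
have [B HB] := fc.
have ubP e : P e -> (e <= B)%N.
  move=> /asboolP[a [b [/HB h <-]]]; apply: leq_trans h.
  by rewrite /mdeg (bigD1 j) //= leq_addr.
have [lo /asboolP[a1 [b1 [cab1 a1j]]] minlo] := ex_minnP exP.
have [hi /asboolP[a2 [b2 [cab2 a2j]]] maxhi] := ex_maxnP exP ubP.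
have clo a b : c a b != 0 -> (lo <= a j)%N.
  by move=> h; apply: minlo; apply/asboolP; exists a, b.
have chi a b : c a b != 0 -> (a j <= hi)%N.
  by move=> h; apply: maxhi; apply/asboolP; exists a, b.
have [jl ul] := andP ujl.
have [|||s1 [us1 ss1 cs1]] := IHl d.+1 (fun x y => if x j == lo then c x y else 0).
- by [].
- by exists a1, b1; rewrite a1j eqxx.
- by exists B => a b; case: ifP => [_ /HB|]; rewrite ?eqxx.
have [c' fc' euler] := euler_iter_shifts lo d ujl (mem_head j l) fc.
(* At the top exponent [hi + d.+1] the shifted matrix reproduces a nonzero entry of [c], and the
   Euler factor [hi + d.+1 - lo] is positive there. *)
have ex_c' : exists a b, c' a b != 0.
  apply: contrapT => /forallNP h.
  have c'0 : c' = fun _ _ => 0.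
    apply/funext => a; apply/funext => b; apply/eqP/contraT => h'.
    by case: (h a); exists b.
  have := euler (iter d.+1 (mup j) a2) (iter d.+1 (mup j) b2).
  rewrite c'0 iter_shifts0 (iter_shifts_top _ _ chi) // => /eqP.
  rewrite mulf_eq0 (negPf cab2) orbF iter_mup a2j subr_eq0 eqr_nat.
  by have := clo _ _ cab2; rewrite a2j; lia.
have [s2 [us2 ss2 cs2]] := IHd c' ex_c' fc'.
(* Shifts along [l] leave the exponent of [z_j] alone, so everything off the slice [lo] stays
   zero. *)
have s1lo ab : ab \in s1 -> ab.1 j = lo.
  move=> /cs1 h; apply/eqP; move: h; apply: contraNT => h.
  rewrite (@iter_shifts_local l d.+1 (fun _ x _ => x j != lo)%N _ (fun _ _ => 0)).
  - by rewrite iter_shifts0.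
  - move=> _ k x y kl _ _; rewrite ffunE; case: (eqVneq j k) kl jl => [-> ->//|_ _ _ xj].
    by rewrite /= subn0.
  - by move=> x y /negPf->.
  - exact: h.
(* The lists are disjoint: the Euler factor vanishes on [s1] and not on [s2]. *)
exists (s1 ++ s2); split.
- rewrite cat_uniq us1 us2 andbT /=; apply/hasPn => ab /cs2; rewrite -euler.
  by apply: contra => /s1lo ->; rewrite subrr mul0r.
- rewrite size_cat ss1 ss2 /= !addnS !addSn !subn1 /= -addnS.
  by rewrite addnS binS.
- move=> ab; rewrite mem_cat => /orP[abs|/cs2].
    by rewrite (iter_shifts_bottom _ _ clo) ?s1lo // cs1.
  by rewrite -euler mulf_eq0 negb_or => /andP[].
Qed.

End Shift.

(** * Weights separating exponents, and the lower bound for the rank *)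

Lemma digits_inj (B n : nat) (f g : nat -> nat) :
  (forall i, (i < n)%N -> (f i < B)%N /\ (g i < B)%N) ->
  (\sum_(i < n) f i * B ^ i = \sum_(i < n) g i * B ^ i)%N ->
  forall i, (i < n)%N -> f i = g i.
Proof.
elim: n f g => [|n IH] f g fgB; first by move=> _ [].
have [f0B g0B] := fgB 0%N isT.
have B0 : (0 < B)%N by exact: leq_ltn_trans f0B.
have E (h : nat -> nat) : (\sum_(i < n.+1) h i * B ^ i =
    (\sum_(i < n) h i.+1 * B ^ i) * B + h 0)%N.
  rewrite big_ord_recl expn0 muln1 addnC big_distrl /=; congr addn.
  by apply: eq_bigr => i _; rewrite /bump /= add1n expnSr mulnA.
rewrite !E => efg.
have e0 : f 0%N = g 0%N.
  by have /(congr1 (modn^~ B)) := efg; rewrite !modnMDl !modn_small.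
move/eqP: efg; rewrite e0 eqn_add2r eqn_pmul2r // => /eqP efg [|i] // ltin.
exact: (IH (f \o succn) (g \o succn) (fun i => fgB i.+1) efg i ltin).
Qed.

Section Weight.
Variables (n B : nat).
Implicit Types (a b : multi_index n).

(** Exponents read as base-[B] digits, so that a single number tells apart multi-indices of degree
    below [B]. *)
Definition weight a : nat := (\sum_j a j * B ^ j)%N.

Lemma coord_le_mdeg a j : (a j <= mdeg a)%N.
Proof. by rewrite /mdeg (bigD1 j) //= leq_addr. Qed.

Lemma weight_inj a b : (mdeg a < B)%N -> (mdeg b < B)%N ->
  weight a = weight b -> a = b.
Proof.
move=> aB bB ab; apply/ffunP => j.
pose ext (a : multi_index n) (i : nat) := if insub i is Some k then a k else 0%N.
have extE (c : multi_index n) (k : 'I_n) : ext c k = c k by rewrite /ext valK.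
rewrite -(extE a) -(extE b); apply: (@digits_inj B n) => // [i lt_in|].
  have -> : i = val (Ordinal lt_in) by []. rewrite !extE.
  by split; [apply: leq_ltn_trans aB|apply: leq_ltn_trans bB]; exact: coord_le_mdeg.
under eq_bigr do rewrite extE.
by under [RHS]eq_bigr do rewrite extE.
Qed.

Lemma weight_le_mdeg a : (0 < B)%N -> (weight a <= mdeg a * B ^ n)%N.
Proof.
move=> B0; rewrite /mdeg big_distrl /=; apply: leq_sum => j _.
by rewrite leq_mul2l leq_pexp2l ?orbT // ltnW.
Qed.

End Weight.

Lemma independent_rows_iter_shifts (K : numFieldType) (n d : nat)
    (c : multi_index n -> multi_index n -> K) :
  (exists a b, c a b != 0) ->
  exists s : 'I_('C(n + d - 1, d)) -> multi_index n,
    independent_rows (iter d (shifts (enum 'I_n)) c) s.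
Proof.
move=> [a0 [b0 c0]]; pose p := mdeg a0; pose q := mdeg b0.
(* [B] exceeds the degrees [p + d] and [q + d] reached after [d] shifts. [M] bounds [w b] in degree
   [q], so that [w a + M - w b] stays a natural number. *)
pose B := (p + q + d).+1; pose w := @weight n B; pose M := (q * B ^ n)%N.
have w_down j (a : multi_index n) : (0 < a j)%N -> w a = (w (mdown j a) + B ^ j)%N.
  exact: weighted_mdown.
pose P v := `[< exists a b, [/\ c a b != 0, mdeg a = p, mdeg b = q &
                                (v + w b = w a + M)%N] >].
have exP : exists v, P v.
  exists (w a0 + M - w b0)%N; apply/asboolP; exists a0, b0; split => //.
  by rewrite subnK // (leq_trans (@weight_le_mdeg n B b0 isT)) // leq_addl.
have ubP v : P v -> (v <= p * B ^ n + M)%N.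
  move=> /asboolP[a [b [_ ap _]]] vb; rewrite -(leq_add2r (w b)) vb -addnA leq_add //.
    by rewrite -ap; exact: weight_le_mdeg.
  exact: leq_addr.
have [v /asboolP[mu [nu [cmn mup nuq vmn]]] vmax] := ex_maxnP exP ubP.
(* After [i] shifts: the pairs of bidegree [(p + i, q + i)] at which [w a - w b] equals its maximum,
   attained at [(mu, nu)]. *)
pose onQ i a b := [&& mdeg a == p + i, mdeg b == q + i & w a + w nu == w b + w mu]%N.
pose c' a b := if onQ 0 a b then c a b else 0.
(* A shift adds 1 to both degrees and [B ^ j] to both weights, so restricting to these pairs
   commutes with shifting. *)
have onQ_down i j (a b : multi_index n) : (0 < a j)%N -> (0 < b j)%N ->
    onQ i.+1 a b = onQ i (mdown j a) (mdown j b).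
  move=> aj bj; rewrite /onQ (mdeg_mdown aj) (mdeg_mdown bj).
  rewrite (w_down _ _ aj) (w_down _ _ bj).
  by rewrite !addnS !eqSS -!(addnAC _ _ (B ^ j)%N) eqn_add2r.
pose T := iter d (@shifts K n (enum 'I_n)).
have T'E a b : onQ d a b -> T c' a b = T c a b.
  apply: (iter_shifts_local (Q := onQ)) => [i j x y _ xj yj|x y h].
    by rewrite (onQ_down _ j).
  by rewrite /c' h.
have T'0 a b : T c' a b != 0 -> onQ d a b.
  apply: contraNT => h; apply/eqP.
  rewrite [LHS](iter_shifts_local (Q := fun i a b => ~~ onQ i a b)
    (g := fun _ _ => 0)) //.
  - by rewrite iter_shifts0.
  - by move=> i j x y _ xj yj; rewrite (onQ_down _ j).
  - by move=> x y; rewrite /c' => /negPf->.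
(* Triangularity: a nonzero entry here would come from an entry of [c] whose weight difference
   exceeds the maximum [v]. *)
have Tabove a b : mdeg a = (p + d)%N -> mdeg b = (q + d)%N ->
    (w b + w mu < w a + w nu)%N -> T c a b = 0.
  move=> ap bq ab.
  rewrite [LHS](iter_shifts_local (g := fun _ _ => 0)
    (Q := fun i a b => [&& mdeg a == p + i, mdeg b == q + i &
                         w b + w mu < w a + w nu]%N)) //.
  - by rewrite iter_shifts0.
  - move=> i j x y _ xj yj.
    rewrite (mdeg_mdown xj) (mdeg_mdown yj) (w_down _ _ xj) (w_down _ _ yj).
    by rewrite !addnS !eqSS -!(addnAC _ _ (B ^ j)%N) ltn_add2r.
  - move=> x y; rewrite !addn0 => /and3P[/eqP xp /eqP yq xy].
    apply/eqP/contraT => cxy.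
    have wy : (w y <= M)%N by rewrite /M -yq; exact: weight_le_mdeg.
    have /vmax : P (w x + M - w y)%N.
      apply/asboolP; exists x, y; split => //.
      by rewrite subnK // (leq_trans wy) // leq_addl.
    by lia.
  - by rewrite ap bq !eqxx.
have [||| s [us ss cs]] := @card_support_iter_shifts K n (enum 'I_n) d c'.
- exact: enum_uniq.
- by exists mu, nu; rewrite /c' /onQ !addn0 mup nuq !eqxx addnC eqxx.
- exists p => a b; rewrite /c' /onQ; case: ifP => [/andP[/eqP-> _]|_].
    by rewrite addn0.
  by rewrite eqxx.
rewrite size_enum_ord in ss; rewrite -ss.
pose t := nth (mu, nu) s.
have onQt (i : 'I_(size s)) : onQ d (t i).1 (t i).2.
  by apply: T'0; apply: cs; exact: mem_nth.
have Tt (i : 'I_(size s)) : T c (t i).1 (t i).2 != 0.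
  by rewrite -T'E //; apply: cs; exact: mem_nth.
(* On the extremal pairs [w a] fixes [w b], and both degrees are below [B], so the weight of the row
   determines the pair. *)
have wt_inj (i k : 'I_(size s)) : w (t i).1 = w (t k).1 -> i = k.
  move=> ik; apply/val_inj/eqP.
  rewrite -(nth_uniq (mu, nu) (ltn_ord i) (ltn_ord k) us).
  have /and3P[/eqP ai /eqP bi /eqP wi] := onQt i.
  have /and3P[/eqP ak /eqP bk /eqP wk] := onQt k.
  apply/eqP; rewrite -/t [t i]surjective_pairing [t k]surjective_pairing.
  congr pair; apply: (@weight_inj n B); rewrite ?ai ?bi ?ak ?bk // -/w /B; lia.
exists (fun i => (t i).1) => l hl i.
apply/eqP/contraT => li.
(* Among the rows with nonzero coefficient, take the one of least weight. In its own column all the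
   others have larger weight, hence lie in the zero region [Tabove]. *)
have [k lk kmin] := @arg_minnP _ i (fun i => l i != 0) (fun i => w (t i).1) li.
have := hl (t k).2; rewrite (bigD1 k) //= big1 ?addr0 => [/eqP|j jk].
  by rewrite mulf_eq0 (negPf lk) (negPf (Tt k)).
have [->|lj] := eqVneq (l j) 0; first by rewrite mul0r.
have /and3P[/eqP aj _ _] := onQt j.
have /and3P[_ /eqP bk /eqP wk] := onQt k.
rewrite [X in _ * X]Tabove ?mulr0 // -wk ltn_add2r ltn_neqAle kmin // andbT.
by apply: contraNneq jk => /wt_inj ->.
Qed.

(** * Unordered sums under scaling and reindexing *)

Section UnorderedSums.
Variables (K : numFieldType) (I : choiceType).
Implicit Types (x y : I -> K) (l : K).

Lemma partial_sumE x (A : {fset I}) :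
  summability.partial_sum x A = \sum_(i <- A) x i.
Proof. by rewrite /summability.partial_sum big_seq_fsetE. Qed.

Lemma cvg_totallyP x l :
  summability.partial_sum x @ summability.totally --> l <->
  forall e, 0 < e -> exists A0 : {fset I}, forall A : {fset I},
    (A0 `<=` A)%fset -> `|l - \sum_(i <- A) x i| < e.
Proof.
split=> [/cvgrPdist_lt h e /h [A0 _ hA]|h].
  by exists A0 => A /hA /=; rewrite partial_sumE.
apply/cvgrPdist_lt => e /h[A0 hA]; exists A0 => // A /hA /=.
by rewrite partial_sumE.
Qed.

(** Models the product of a series with [|z_j|^2]: terms are scaled by [k] and moved by the
    injection [u], with zeros off its image. A finite set containing the image of [A0] pulls back to
    one containing [A0]. *)
Lemma cvg_totally_reindex (u v : I -> I) (P : pred I) k x y l :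
  cancel u v -> (forall i, P (u i)) -> (forall i, P i -> u (v i) = i) ->
  (forall i, y i = if P i then k * x (v i) else 0) ->
  summability.partial_sum x @ summability.totally --> l ->
  summability.partial_sum y @ summability.totally --> k * l.
Proof.
move=> uK Pu vK yE /cvg_totallyP xl; apply/cvg_totallyP => e e0.
(* The added 1 keeps the divisor positive when [k] is 0. *)
have k0 : 0 < `|k| + 1 by rewrite ltr_wpDl.
have [A0 hA0] := xl (e / (`|k| + 1)) (divr_gt0 e0 k0).
exists [fset u i | i in A0]%fset => A /fsubsetP A0A.
pose B := [fset i in A | P i]%fset.
pose A' := [fset v i | i in B]%fset.
have sA' : (A0 `<=` A')%fset.
  apply/fsubsetP => i iA0; apply/imfsetP; exists (u i); last by rewrite uK.
  by rewrite !inE /= Pu andbT; apply: A0A; apply/imfsetP; exists i.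
have -> : \sum_(i <- A) y i = k * \sum_(i <- A') x i.
  rewrite mulr_sumr big_imfset /=; last first.
    by move=> i j; rewrite !inE => /andP[_ /vK {2}<-] /andP[_ /vK {2}<-] ->.
  rewrite -big_fset_condE /= [in RHS]big_mkcond.
  by apply: eq_bigr => i _; rewrite yE.
rewrite -mulrBr normrM;
apply: le_lt_trans (_ : (`|k| + 1) * `|l - \sum_(i <- A') x i| < e).
  by rewrite ler_wpM2r // lerDl.
by rewrite mulrC -ltr_pdivlMr // hA0.
Qed.

End UnorderedSums.

(** * Expansions of sums and of multiples of [sqnorm z ^+ d] *)

Section Expansions.
Variables (R : realType) (n : nat).
Local Notation C := (Cx R).
Implicit Types (z : 'rV[C]_n) (F G : 'rV[C]_n -> C).
Implicit Types (c : multi_index n -> multi_index n -> C).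

Lemma monomial_mup j (a : multi_index n) z :
  monomial (mup j a) z = z 0 j * monomial a z.
Proof.
rewrite /monomial (bigD1 j) //= [in RHS](bigD1 j) //= ffunE eqxx addn1 exprS mulrA.
by congr (_ * _); apply: eq_bigr => k /negPf kj; rewrite ffunE kj addn0.
Qed.

Lemma is_expansion_shift j F c : is_expansion F c ->
  is_expansion (fun z => `|z 0 j| ^+ 2 * F z) (shift j c).
Proof.
rewrite /is_expansion; apply: filterS => z Fz.
pose u (i : multi_index n * multi_index n) := (mup j i.1, mup j i.2).
pose v (i : multi_index n * multi_index n) := (mdown j i.1, mdown j i.2).
apply: (@cvg_totally_reindex _ _ u v (fun i => (0 < i.1 j)%N && (0 < i.2 j)%N)) Fz.
- by case=> a b; rewrite /u /v /= !mupK.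
- by case=> a b; rewrite /u /= !ffunE eqxx !addn1.
- by case=> a b /= /andP[aj bj]; rewrite /u /v /= !mdownK.
- case=> a b; rewrite /expansion_term /shift /=;
  case: ifP => [/andP[aj bj]|]; last by rewrite !mul0r.
  rewrite -{2}(mdownK aj) -{2}(mdownK bj) !monomial_mup /= mxE normCK.
  by ring.
Qed.

Lemma is_expansion0 : is_expansion (fun _ => 0) (fun (_ _ : multi_index n) => 0 : C).
Proof.
apply: filterE => z; apply/cvg_totallyP => e e0; exists fset0 => A _.
by rewrite big1 ?subrr ?normr0 // => i _; rewrite /expansion_term !mul0r.
Qed.

Lemma is_expansionD F G f g : is_expansion F f -> is_expansion G g ->
  is_expansion (fun z => F z + G z) (fun a b => f a b + g a b).
Proof.
rewrite /is_expansion; apply: filterS2 => z hF hG.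
rewrite (_ : summability.partial_sum _ = fun A =>
  summability.partial_sum (expansion_term f z) A +
  summability.partial_sum (expansion_term g z) A).
  exact: (cvgD hF hG).
apply/funext => A; rewrite !partial_sumE -big_split /=.
by apply: eq_bigr => i _; rewrite /expansion_term !mulrDl.
Qed.

Lemma is_expansionN F f : is_expansion F f ->
  is_expansion (fun z => - F z) (fun a b => - f a b).
Proof.
rewrite /is_expansion; apply: filterS => z hF.
rewrite (_ : summability.partial_sum _ = fun A =>
  - summability.partial_sum (expansion_term f z) A).
  exact: (cvgN hF).
apply/funext => A; rewrite !partial_sumE -sumrN.
by apply: eq_bigr => i _; rewrite /expansion_term !mulNr.
Qed.

Lemma is_expansion_iter_shifts d F c : is_expansion F c ->
  is_expansion (fun z => sqnorm z ^+ d * F z) (iter d (shifts (enum 'I_n)) c).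
Proof.
move=> Fc; elim: d => [|d IH].
  by rewrite [X in is_expansion X](_ : _ = F) //; apply/funext => z; rewrite mul1r.
rewrite iterS; set g := iter d _ c in IH *; set G := fun z => _ in IH.
rewrite [X in is_expansion X](_ : _ =
    fun z => \sum_(j <- enum 'I_n) `|z 0 j| ^+ 2 * G z); last first.
  by apply/funext => z; rewrite exprS -mulrA /sqnorm mulr_suml big_enum.
elim: (enum 'I_n) => [|j l IHl].
  rewrite [X in is_expansion X _](_ : _ = fun=> 0); last first.
    by apply/funext => z; rewrite big_nil.
  rewrite [X in is_expansion _ X](_ : _ = fun _ _ => 0); first exact: is_expansion0.
  by apply/funext => a; apply/funext => b; rewrite /shifts big_nil.
rewrite [X in is_expansion X _](_ : _ = fun z =>
    `|z 0 j| ^+ 2 * G z + \sum_(k <- l) `|z 0 k| ^+ 2 * G z); last first.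
  by apply/funext => z; rewrite big_cons.
rewrite [X in is_expansion _ X](_ : _ = fun a b =>
   shift j g a b + shifts l g a b); last first.
  by apply/funext => a; apply/funext => b; rewrite /shifts big_cons.
by apply: is_expansionD IHl; exact: is_expansion_shift.
Qed.

End Expansions.

(** * Polynomial identities in a variable and its conjugate *)

Lemma poly_nat_roots0 (K : numDomainType) (p : {poly K}) :
  (forall m : nat, p.[m%:R] = 0) -> p = 0.
Proof.
move=> p0; apply/eqP/contraT => pn0.
have := @max_poly_roots _ p [seq m%:R | m <- iota 0 (size p)] pn0.
rewrite size_map size_iota ltnn => -> //.
- by apply/allP => _ /mapP[m _ ->]; rewrite rootE p0.
- by rewrite map_inj_uniq ?iota_uniq //; exact: mulrIn (oner_neq0 K).
Qed.

(** The exponents [a i] may repeat, so only the sum over each fiber is determined. Applied in two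
    variables in turn, this isolates each pair of exponents. *)
Lemma horner_coef_unique (K : numDomainType) (I : eqType) (s : seq I) (c : I -> K)
    (a : I -> nat) :
  (forall u, \sum_(i <- s) c i * u ^+ a i = 0) ->
  forall k, \sum_(i <- s | a i == k) c i = 0.
Proof.
move=> cu k.
have /(congr1 (coefp k)) : \sum_(i <- s) c i *: 'X^(a i) = 0 :> {poly K}.
  apply: poly_nat_roots0 => m; rewrite horner_sum -[RHS](cu m%:R).
  by apply: eq_bigr => i _; rewrite !hornerE.
rewrite /= coef0 coef_sum => coefk; rewrite -[RHS]coefk big_mkcond; apply: eq_bigr => i _.
by rewrite coefZ coefXn eq_sym; case: eqP; rewrite ?mulr1 ?mulr0.
Qed.

(* In a polynomial identity in [zeta] and its conjugate, the two may be treated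
   as independent: it holds for [s + i t] and [s - i t] with [s], [t] natural,
   hence with [s], [t] arbitrary complex numbers. *)
Lemma conj_coef_unique (K : numClosedFieldType) (I : eqType) (s : seq I) (c : I -> K)
    (a b : I -> nat) :
  uniq s -> {in s &, injective (fun i => (a i, b i))} ->
  (forall z : K, \sum_(i <- s) c i * z ^+ a i * (z^* ) ^+ b i = 0) ->
  forall i, i \in s -> c i = 0.
Proof.
move=> us abI cz.
have c_nat_nat (x y : nat) :
    \sum_(i <- s) c i * (x%:R + 'i * y%:R) ^+ a i * (x%:R - 'i * y%:R) ^+ b i = 0.
  rewrite -[RHS](cz (x%:R + 'i * y%:R)); apply: eq_bigr => i _.
  by rewrite rmorphD rmorphM /= conjCi !conjC_nat mulNr.
have c_all_nat u (y : nat) :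
    \sum_(i <- s) c i * (u + 'i * y%:R) ^+ a i * (u - 'i * y%:R) ^+ b i = 0.
  pose p := \sum_(i <- s)
    c i *: (('X + ('i * y%:R)%:P) ^+ a i * ('X - ('i * y%:R)%:P) ^+ b i).
  have pE v : p.[v] = \sum_(i <- s) c i * (v + 'i * y%:R) ^+ a i * (v - 'i * y%:R) ^+ b i.
    by rewrite horner_sum; apply: eq_bigr => i _; rewrite !hornerE.
  by rewrite -pE (@poly_nat_roots0 _ p) ?horner0 // => x; rewrite pE.
have c_all u v :
    \sum_(i <- s) c i * (u + 'i * v) ^+ a i * (u - 'i * v) ^+ b i = 0.
  pose p := \sum_(i <- s) c i *: ((u%:P + 'i *: 'X) ^+ a i * (u%:P - 'i *: 'X) ^+ b i).
  have pE w : p.[w] = \sum_(i <- s) c i * (u + 'i * w) ^+ a i * (u - 'i * w) ^+ b i.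
    by rewrite horner_sum; apply: eq_bigr => i _; rewrite !hornerE.
  by rewrite -pE (@poly_nat_roots0 _ p) ?horner0 // => x; rewrite pE.
(* The linear change from [(s, t)] to [(s + i t, s - i t)] is invertible. *)
have c_uv u v : \sum_(i <- s) c i * u ^+ a i * v ^+ b i = 0.
  have i0 : 'i != 0 :> K by rewrite neq0Ci.
  rewrite -[RHS](c_all ((u + v) / 2) ((u - v) / (2 * 'i))).
  apply: eq_bigr => i _; congr (_ * _ ^+ _ * _ ^+ _); field; exact: i0.
move=> i0 i0s.
have : \sum_(i <- [seq i <- s | a i == a i0] | b i == b i0) c i = 0.
  apply: horner_coef_unique => v; rewrite big_filter.
  apply: (@horner_coef_unique _ _ s (fun i => c i * v ^+ b i) a) => u.
  by rewrite -[RHS](c_uv u v); apply: eq_bigr => i _; rewrite mulrAC.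
rewrite big_filter_cond (bigID (pred1 i0)) /= [X in _ + X]big1_seq ?addr0.
  rewrite (eq_bigl (pred1 i0)) => [|i]; last first.
    by rewrite /=; case: (eqVneq i i0) => [->|]; rewrite ?eqxx ?andbF.
  by rewrite -big_filter filter_pred1_uniq // big_seq1.
move=> i /andP[/andP[/andP[/eqP ai /eqP bi] /eqP ni] si].
by case: ni; apply: abI; rewrite /= ?ai ?bi.
Qed.

(** * Absolute convergence and the lowest-degree part of a vanishing series *)

Section AbsoluteConvergence.
Variables (K : numClosedFieldType) (I : choiceType).
Implicit Types (x : I -> K) (A B : {fset I}).

(* Splitting the real and imaginary parts by sign. *)
Lemma sum_norm_le x B M :
  (forall P : pred I, `|\sum_(i <- B | P i) x i| <= M) ->
  \sum_(i <- B) `|x i| <= M *+ 4.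
Proof.
move=> xM.
have real_part (f : I -> K) : (forall i, f i \is Num.real) ->
    (forall P : pred I, `|\sum_(i <- B | P i) f i| <= M) ->
    \sum_(i <- B) `|f i| <= M *+ 2.
  move=> fR fM; rewrite (bigID (fun i => 0 <= f i)) /= mulr2n lerD //.
    apply: le_trans (fM (fun i => 0 <= f i)).
    rewrite (eq_bigr f) => [|i fi]; last by rewrite ger0_norm.
    by rewrite real_ler_norm ?rpred_sum.
  apply: le_trans (fM (fun i => ~~ (0 <= f i))).
  rewrite (eq_bigr (fun i => - f i)) => [|i fi]; last first.
    by rewrite ltr0_norm // real_ltNge ?real0.
  by rewrite sumrN -normrN real_ler_norm // rpredN rpred_sum.
apply: (@le_trans _ _ (\sum_(i <- B) `|'Re (x i)| + \sum_(i <- B) `|'Im (x i)|)).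
  rewrite -big_split /=; apply: ler_sum => i _.
  rewrite {1}[x i]Crect; apply: le_trans (ler_normD _ _) _.
  by rewrite normrM normCi mul1r.
rewrite (mulrnDr M 2 2); apply: lerD; apply: real_part => [i|P].
- exact: Creal_Re.
- rewrite -raddf_sum; apply: le_trans (xM P).
  by have [] := leif_normC_Re_Creal (\sum_(i <- B | P i) x i).
- exact: Creal_Im.
rewrite -raddf_sum; apply: le_trans (xM P).
set S := \sum_(i <- B | P i) x i.
have -> : `|'Im S| = `|'Re ('i * S)| by rewrite ReMil normrN.
have [le_Re _] := leif_normC_Re_Creal ('i * S).
by rewrite (le_trans le_Re) // normrM normCi mul1r.
Qed.

(** Past some finite [A0] all partial sums are within 1 of the limit. A finite sum outside [A0] is a
    difference of two of them, so its norm is at most 2, and [sum_norm_le] bounds the sum of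
    norms. *)
Lemma cvg_totally_bounded x (l : K) :
  summability.partial_sum x @ summability.totally --> l ->
  exists2 M, 0 <= M & forall A, \sum_(i <- A) `|x i| <= M.
Proof.
move=> /cvg_totallyP /(_ _ ltr01)[A0 hA0].
exists (\sum_(i <- A0) `|x i| + 2 *+ 4) => [|A].
  by rewrite addr_ge0 ?sumr_ge0 // mulrn_wge0.
rewrite (big_fsetID _ (mem A0)) /= lerD //.
  rewrite [X in X <= _](_ : _ = \sum_(i <- A0 | i \in A) `|x i|).
    rewrite [leRHS](bigID (fun i => i \in A)) /= lerDl sumr_ge0 //.
  rewrite [in RHS]big_fset_condE; apply: eq_fbig => // i.
  by rewrite !inE andbC.
apply: sum_norm_le => P; rewrite big_fset_condE /=.
set B := [fset i in _ | P i]%fset.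
have -> : \sum_(i <- B) x i =
   (l - \sum_(i <- A0) x i) - (l - \sum_(i <- (A0 `|` B)%fset) x i).
  rewrite [X in _ - (_ - X)](big_fsetID _ (mem A0)) /=.
  have -> : [fset i in A0 `|` B | i \in A0]%fset = A0.
    by apply/fsetP => i; rewrite !inE /= andb_orl andbb orb_idr // => /andP[].
  have -> : [fset i in A0 `|` B | i \notin A0]%fset = B.
    by apply/fsetP => i; rewrite !inE /=; case: (i \in A0); rewrite ?andbF ?andbT.
  by ring.
rewrite (le_trans (ler_normB _ _)) // -[2]/(1 + 1) lerD // ltW // hA0 //.
exact: fsubsetUl.
Qed.

(* Dividing by [t ^ k] and letting [t] tend to 0. *)
Lemma lowest_degree_part_eq0 x (deg : I -> nat) (k : nat) (D : {fset I}) :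
  (forall i, (i \in D) = (deg i == k)) ->
  (forall i, x i != 0 -> (k <= deg i)%N) ->
  (forall t : K, 0 < t -> t <= 1 ->
    summability.partial_sum (fun i => t ^+ deg i * x i) @
      summability.totally --> (0 : K)) ->
  \sum_(i <- D) x i = 0.
Proof.
move=> inD xk x0.
have [M M0 xM] : exists2 M, 0 <= M & forall A, \sum_(i <- A) `|x i| <= M.
  apply: cvg_totally_bounded; have := x0 1 ltr01 (lexx _).
  by under eq_fun do rewrite expr1n mul1r; exact.
set S := \sum_(i <- D) x i; apply/eqP/contraT => S0.
have v0 : 0 < `|S| by rewrite normr_gt0.
have den0 : 0 < 1 + M + `|S| by rewrite addr_gt0 // ltr_pwDl.
(* Chosen so that [t * (1 + M)] is less than the norm of [S]: the 1 pays for the tolerance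
   [t ^+ k.+1], and [M] for the terms of higher degree. *)
pose t := `|S| / (1 + M + `|S|).
have t0 : 0 < t by rewrite divr_gt0.
have t1 : t <= 1 by rewrite ler_pdivrMr // mul1r lerDr addr_ge0.
have /cvg_totallyP /(_ _ (exprn_gt0 k.+1 t0))[A0 hA0] := x0 t t0 t1.
have := hA0 (A0 `|` D)%fset (fsubsetUl _ _).
rewrite sub0r normrN (big_fsetID _ (mem D)) /=.
have -> : [fset i in (A0 `|` D) | i \in D]%fset = D.
  by apply/fsetP => i; rewrite !inE /= andb_orl andbb orb_idl // => /andP[].
set E := [fset i in _ | _]%fset.
rewrite (eq_big_seq (fun i => t ^+ k * x i)) => [|i]; last by rewrite inD => /eqP->.
rewrite -mulr_sumr -/S => lt_t.
have tail : `|\sum_(i <- E) t ^+ deg i * x i| <= t ^+ k.+1 * M.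
  apply: le_trans (ler_norm_sum _ _ _) _.
  apply: (@le_trans _ _ (t ^+ k.+1 * \sum_(i <- E) `|x i|)); last first.
    by rewrite ler_wpM2l ?exprn_ge0 // ltW.
  rewrite mulr_sumr big_seq [leRHS]big_seq; apply: ler_sum => i.
  rewrite !inE /= => /andP[_ iD].
  rewrite normrM ger0_norm ?exprn_ge0 ?(ltW t0) //.
  have [->|xi] := eqVneq (x i) 0; first by rewrite normr0 !mulr0.
  have ki : (k < deg i)%N by rewrite ltn_neqAle xk // andbT eq_sym -inD.
  by rewrite ler_wpM2r // ler_wiXn2l // ltW.
have : t ^+ k * `|S| < t ^+ k.+1 * (1 + M).
  rewrite -[t ^+ k]ger0_norm ?exprn_ge0 ?(ltW t0) // -normrM.
  rewrite -[t ^+ k * S](addrK (\sum_(i <- E) t ^+ deg i * x i)).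
  by rewrite (le_lt_trans (ler_normB _ _)) // mulrDr mulr1 ltr_leD.
rewrite exprSr -mulrA ltr_pM2l ?exprn_gt0 // /t mulrAC -mulrA ltr_pMr //.
by rewrite ltr_pdivlMr // mul1r gtrDl lt_gtF.
Qed.

End AbsoluteConvergence.

(** * Uniqueness of the coefficients of an expansion *)

Section Uniqueness.
Variables (R : realType) (n : nat).
Local Notation C := (Cx R).
Implicit Types (z : 'rV[C]_n) (F : 'rV[C]_n -> C).
Implicit Types (c : multi_index n -> multi_index n -> C).

Lemma monomialZ (a : multi_index n) (t : C) z :
  monomial a (t *: z) = t ^+ mdeg a * monomial a z.
Proof.
rewrite /monomial /mdeg -prodrXr -big_split /=.
by apply: eq_bigr => j _; rewrite mxE exprMn.
Qed.

Lemma expansion_termZ c (t : C) z i : t \is Num.real ->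
  expansion_term c (t *: z) i =
  t ^+ (mdeg i.1 + mdeg i.2) * expansion_term c z i.
Proof.
move=> tR; have -> : expansion_term c (t *: z) i =
    c i.1 i.2 * monomial i.1 (t *: z) * monomial i.2 (t *: conj_vec z).
  congr (_ * monomial _ _); apply/matrixP => x y.
  by rewrite !mxE rmorphM /= conj_Creal.
by rewrite !monomialZ /expansion_term exprD; ring.
Qed.

(** Total degree [k] forces every exponent to be at most [k], which leaves finitely many candidates
    to filter. *)
Definition mpairs (k : nat) : {fset multi_index n * multi_index n} :=
  [fset i in [seq ([ffun j => val (f.1 j)], [ffun j => val (f.2 j)]) |
    f : {ffun 'I_n -> 'I_k.+1} * {ffun 'I_n -> 'I_k.+1}] |
    (mdeg i.1 + mdeg i.2 == k)%N]%fset.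

Lemma mem_mpairs k i : (i \in mpairs k) = (mdeg i.1 + mdeg i.2 == k)%N.
Proof.
rewrite /mpairs !inE /=; apply: andb_idl => /eqP ik.
have le_k (a : multi_index n) j : (mdeg a <= k)%N -> (a j < k.+1)%N.
  by move=> ak; rewrite ltnS (leq_trans (coord_le_mdeg a j)).
have ik1 : (mdeg i.1 <= k)%N by rewrite -ik leq_addr.
have ik2 : (mdeg i.2 <= k)%N by rewrite -ik leq_addl.
apply/mapP; exists ([ffun j => inord (i.1 j)], [ffun j => inord (i.2 j)]).
  by rewrite mem_enum.
rewrite [LHS]surjective_pairing; congr pair; apply/ffunP => j;
  by rewrite !ffunE /= inordK // le_k.
Qed.

Lemma expansion0_unique c : is_expansion (fun _ => 0) c -> c = fun _ _ => 0.
Proof.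
move=> /nbhs_norm0P[e /= e0 he].
apply/funext => a; apply/funext => b; apply/eqP/contraT => cab.
pose P k := `[< exists i, c i.1 i.2 != 0 /\ (mdeg i.1 + mdeg i.2 = k)%N >].
have exP : exists k, P k.
  by exists (mdeg a + mdeg b)%N; apply/asboolP; exists (a, b).
have [k /asboolP[i [ci ik]] kmin] := ex_minnP exP.
have part0 z : \sum_(i <- mpairs k) expansion_term c z i = 0.
  have den0 : 0 < `|z| + 1 by rewrite ltr_wpDl.
  (* [z] is arbitrary, but convergence is known only within distance [e] of 0. The factor [t0]
     brings [z] into that ball, and homogeneity of degree [k] removes it afterwards. *)
  pose t0 := e / (`|z| + 1) / 2.
  have t00 : 0 < t0 by rewrite !divr_gt0.
  have : \sum_(i <- mpairs k) expansion_term c (t0 *: z) i = 0.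
    apply: (@lowest_degree_part_eq0 _ _ _ (fun i => mdeg i.1 + mdeg i.2)%N k).
    - by move=> x; rewrite mem_mpairs.
    - move=> x cx; apply: kmin; apply/asboolP; exists x; split=> //.
      by move: cx; apply: contraNneq => cx; rewrite /expansion_term cx !mul0r.
    - move=> t t_gt0 t_le1.
      under eq_fun do rewrite -expansion_termZ ?gtr0_real //.
      apply: he => /=; rewrite !normrZ !gtr0_norm // mulrA.
      rewrite (@le_lt_trans _ _ (t0 * (`|z| + 1))) //.
        apply: ler_pM; [by rewrite mulr_ge0 ?ltW|by []| |by rewrite lerDl].
        by rewrite ler_piMl // ltW.
      by rewrite /t0 mulrAC divfK ?gt_eqF // gtr_pMr // invf_lt1 ?ltr1n.
  rewrite (eq_big_seq (fun x => t0 ^+ k * expansion_term c z x)) => [|x]; last first.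
    by rewrite mem_mpairs expansion_termZ ?gtr0_real // => /eqP->.
  move=> h; apply: (mulfI (lt0r_neq0 (exprn_gt0 k t00))).
  by rewrite mulr0 mulr_sumr.
suff c0 : c i.1 i.2 = 0 by rewrite c0 eqxx in ci.
(* All degrees involved are at most [k], so base [k.+1] keeps the exponents distinct after
   substituting powers of one variable for the [z_j]. *)
pose w := @weight n k.+1.
apply: (@conj_coef_unique _ _ (mpairs k) (fun i => c i.1 i.2)
  (fun i => w i.1) (fun i => w i.2)).
- exact: fset_uniq.
- move=> [a1 b1] [a2 b2]; rewrite !mem_mpairs /= => /eqP k1 /eqP k2 [wa wb].
  by congr pair; apply: (@weight_inj n k.+1) => //; lia.
- move=> u; pose z : 'rV[C]_n := \row_j u ^+ (k.+1 ^ j).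
  rewrite -[RHS](part0 z); apply: eq_bigr => x _; rewrite /expansion_term.
  have monomialE (v : C) (a' : multi_index n) :
      monomial a' (\row_j v ^+ (k.+1 ^ j)) = v ^+ w a'.
    rewrite /monomial /w /weight -prodrXr; apply: eq_bigr => j _.
    by rewrite mxE -exprM mulnC.
  rewrite monomialE; congr (_ * _); rewrite -monomialE; congr monomial.
  by apply/matrixP => ? j; rewrite !mxE rmorphXn.
- by rewrite mem_mpairs ik.
Qed.

Lemma is_expansion_unique F c c' :
  is_expansion F c -> is_expansion F c' -> c = c'.
Proof.
move=> Fc /is_expansionN Fc'; have := is_expansionD Fc Fc'.
under eq_fun do rewrite subrr.
move=> /expansion0_unique h; apply/funext => a; apply/funext => b.
by apply/eqP; rewrite -subr_eq0; apply/eqP; move/(congr1 (fun f => f a b)): h.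
Qed.

Lemma coef_matrixE F c : is_expansion F c -> coef_matrix F = c.
Proof.
move=> Fc; apply: (is_expansion_unique _ Fc).
exact: (@xgetPex _ _ [set c | is_expansion F c] (ex_intro _ c Fc)).
Qed.

Lemma is_expansion_near F G c : (\forall z \near (0 : 'rV[C]_n), F z = G z) ->
  is_expansion F c -> is_expansion G c.
Proof. by rewrite /is_expansion; apply: filterS2 => z ->. Qed.

End Uniqueness.

(** * Upper bound for the rank by counting nonzero rows *)

Section Rank.
Variables (K : fieldType) (I J : Type).
Implicit Type A : I -> J -> K.

(** Together with the next lemma, this bounds the rank by the number of nonzero rows. *)
Lemma independent_rows_inj A k (s : 'I_k -> I) : independent_rows A s -> injective s.
Proof.
move=> h i i' sii'; apply/eqP/contraT => nii'.
suff /eqP : (i == i)%:R - (i == i')%:R = 0 :> K.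
  by rewrite eqxx (negPf nii') subr0 oner_eq0.
apply: (h (fun x => (x == i)%:R - (x == i')%:R)) => j.
under eq_bigr do rewrite mulrBl !mulr_natl !mulrb.
by rewrite sumrB -!big_mkcond /= !big_pred1_eq sii' subrr.
Qed.

Lemma independent_rows_neq0 A k (s : 'I_k -> I) i : independent_rows A s ->
  ~ (forall j, A (s i) j = 0).
Proof.
move=> h A0; have /eqP : (i == i)%:R = 0 :> K; last by rewrite eqxx oner_eq0.
apply: (h (fun x => (x == i)%:R)) => j; apply: big1 => x _.
by case: eqVneq => [->|_]; rewrite ?A0 ?mulr0 ?mul0r.
Qed.

End Rank.

(** Exponents of degree [d] are at most [d], so the indices embed into the tuples counted by
    [card_ord_partitions]. *)
Lemma card_mdeg_le n d k (s : 'I_k -> multi_index n) : (1 <= n)%N ->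
  injective s -> (forall i, mdeg (s i) = d) -> (k <= 'C(n + d - 1, d))%N.
Proof.
case: n s => // m s _ s_inj sd.
have s_le i j : (s i j < d.+1)%N by rewrite ltnS -(sd i) coord_le_mdeg.
pose t i := [tuple (inord (s i j) : 'I_d.+1) | j < m.+1].
have t_inj : injective t.
  move=> i i' tii'; apply: s_inj; apply/ffunP => j.
  have /(congr1 (fun x => val (tnth x j))) := tii'.
  by rewrite !tnth_mktuple /= !inordK.
rewrite addSn subn1 /= -bin_sub ?leq_addl // addnK -card_ord_partitions.
rewrite -[k]card_ord -(card_codom t_inj); apply: subset_leq_card.
apply/fintype.subsetP => _ /codomP[i ->]; rewrite inE big_tuple.
apply/eqP; rewrite -[RHS](sd i).
by apply: eq_bigr => j _; rewrite tnth_mktuple inordK.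
Qed.

(** * The coefficients of [sqnorm z ^+ d] *)

Section Constant.
Variables (R : realType) (n : nat).

Definition one_coef (a b : multi_index n) : Cx R :=
  ((mdeg a == 0) && (mdeg b == 0))%N%:R.

Lemma mdeg_eq0 (a : multi_index n) : (mdeg a == 0%N) = (a == [ffun=> 0%N]).
Proof.
apply/idP/eqP => [|->]; last by rewrite /mdeg big1 // => j _; rewrite ffunE.
rewrite sum_nat_eq0 => /forallP a0; apply/ffunP => j.
by rewrite ffunE; apply/eqP: (a0 j).
Qed.

Lemma is_expansion_one : is_expansion (fun=> 1) one_coef.
Proof.
apply: filterE => z; apply/cvg_totallyP => e e0.
pose i0 : multi_index n * multi_index n := ([ffun=> 0%N], [ffun=> 0%N]).
exists [fset i0]%fset => A; rewrite fsub1set => i0A.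
rewrite (big_fsetD1 i0) //= big1_seq => [|[a b] /=].
  rewrite addr0 /expansion_term /one_coef !mdeg_eq0 !eqxx /monomial.
  by rewrite !big1 ?mulr1 ?subrr ?normr0 // => j _; rewrite ffunE expr0.
rewrite !inE xpair_eqE -!mdeg_eq0 => /andP[/negPf ab _].
by rewrite /expansion_term /one_coef /= ab !mul0r.
Qed.

Lemma is_expansion_sqnormX d :
  is_expansion (fun z => sqnorm z ^+ d) (iter d (shifts (enum 'I_n)) one_coef).
Proof.
rewrite [X in is_expansion X](_ : _ = fun z => sqnorm z ^+ d * 1).
  exact: is_expansion_iter_shifts is_expansion_one.
by apply/funext => z; rewrite mulr1.
Qed.

(** Each shift raises the row degree by one, starting from the single entry of the constant 1 in
    degree 0. *)
Lemma iter_shifts_one_coef d a b : mdeg a != d ->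
  iter d (shifts (enum 'I_n)) one_coef a b = 0.
Proof.
move=> ad; rewrite (iter_shifts_local (g := fun _ _ => 0)
  (Q := fun i a _ => mdeg a != i)) ?iter_shifts0 // => [i j x y _ xj _|x y].
  by rewrite (mdeg_mdown xj) eqSS.
by rewrite /one_coef => /negPf->.
Qed.

End Constant.

(** * The inequality and the case of equality *)

Lemma rankR_ge (R : realType) (n d : nat) (F : 'rV[Cx R]_n -> Cx R) c :
  is_expansion F (iter d (shifts (enum 'I_n)) c) -> (exists a b, c a b != 0) ->
  (('C(n + d - 1, d)%:R)%:E <= rankR F)%E.
Proof.
move=> Fc /(independent_rows_iter_shifts d) [s hs].
rewrite /rankR (coef_matrixE Fc); apply: ereal_sup_ubound => /=.
by exists 'C(n + d - 1, d) => //; exists s.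
Qed.

Theorem theorem2p1 (R : realType) (n d : nat) (n_gt0 : (1 <= n)%N) :
  (forall F r : 'rV[Cx R]_n -> Cx R,
      real_analytic0 F ->
      ~ (\forall z \near (0 : 'rV[Cx R]_n), F z = 0) ->
      real_analytic0 r ->
      (\forall z \near (0 : 'rV[Cx R]_n), F z = sqnorm z ^+ d * r z) ->
      (('C(n + d - 1, d)%:R)%:E <= rankR F)%E) /\
  rankR (fun z : 'rV[Cx R]_n => sqnorm z ^+ d) = ('C(n + d - 1, d)%:R)%:E.
Proof.
split=> [F r _ F0 [c rc] Fr|].
  have Fc : is_expansion F (iter d (shifts (enum 'I_n)) c).
    apply: is_expansion_near (is_expansion_iter_shifts d rc).
    by apply: filterS Fr => z ->.
  (* If [c] were zero, [F] would be the sum of the zero series near the origin, against the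
     assumption on [F]. *)
  apply: (rankR_ge Fc); apply: contrapT => /forallNP c0; apply: F0.
  have c_eq0 : c = fun _ _ => 0.
    apply/funext => a; apply/funext => b; apply/eqP/contraT => cab.
    by case: (c0 a); exists b.
  move: Fc; rewrite c_eq0 iter_shifts0 /is_expansion => Fc.
  have := is_expansion0 R n; rewrite /is_expansion; apply: filterS2 Fc => z Fz.
  exact: (cvg_unique _ Fz).
apply/eqP; rewrite eq_le; apply/andP; split; last first.
  apply: (rankR_ge (is_expansion_sqnormX R n d)).
  by exists [ffun=> 0%N], [ffun=> 0%N]; rewrite /one_coef !mdeg_eq0 !eqxx oner_neq0.
(* Independent rows are distinct and nonzero, and the nonzero rows are indexed by multi-indices of
   degree [d]. *)
rewrite /rankR (coef_matrixE (is_expansion_sqnormX R n d)).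
apply: ge_ereal_sup => _ /= [k [s hs] <-].
rewrite lee_fin ler_nat; apply: (@card_mdeg_le _ _ _ s n_gt0).
  exact: independent_rows_inj hs.
move=> i; apply/eqP/contraT => sd.
by case: (independent_rows_neq0 (i := i) hs) => b; exact: iter_shifts_one_coef.
Qed.
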